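(* Let $n\ge1$ be an integer and let $y_1,\dots,y_n,\hat y_1,\dots,\hat y_n$ be mutually independent random variables, each uniformly distributed on $\{1,2\}$. Let $\sigma_1,\sigma_2$ be the two permutations of $\{1,2\}$, let $\tau_{\sigma}=\frac1n\sum_{i=1}^n\mathbf 1_{\{y_i\neq\sigma(\hat y_i)\}}$ for $\sigma\in\{\sigma_1,\sigma_2\}$, and let $n\tau=\min\{n\tau_{\sigma_1},n\tau_{\sigma_2}\}$. Then for every integer $z\ge0$ the distribution function $F_{n\tau}(z)=\mathbb P(n\tau\le z)$ satisfies $$\mathbb P(n\tau\le z)=\begin{cases}\displaystyle\sum_{i=0}^{z}2\binom{n}{i}\left(\tfrac12\right)^n=2B_{n,1/2}(z) & \text{if } z+1\le\frac n2,\\[2mm] 1 & \text{if } z>\frac n2,\end{cases}$$ where $B_{n,1/2}$ is the distribution function of the binomial distribution with parameters $n$ and $\frac12$.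
   Context: The binomial distribution function is $B_{n,1/2}(z)=\sum_{i=0}^{z}\binom ni 2^{-n}$ for integers $0\le z\le n$. The variables $y_i$ and $\hat y_i$ are the labels of observation $i$ in two independent partitions with two equiprobable clusters, and $\tau$ is called the Matching Error of the two partitions. *)

(* Defs.v *)
From HB Require Import structures.
From mathcomp Require Import all_boot all_order all_algebra.
From mathcomp Require Import perm.
From mathcomp Require Import all_classical all_reals all_analysis.

Set Implicit Arguments.
Unset Strict Implicit.
Unset Printing Implicit Defensive.

Import Order.TTheory GRing.Theory Num.Theory.
Local Open Scope classical_set_scope.
Local Open Scope ring_scope.

(* The two cluster labels {1, 2} are the elements of 'I_2. Finite ordinals
   carry the sigma-algebra of all subsets, as [bool] and [nat] do. *)
HB.instance Definition _ (n : nat) := isPointed.Build 'I_n.+1 ord0.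

HB.instance Definition _ (n : nat) :=
  @isMeasurable.Build default_measure_display 'I_n.+1 discrete_measurable
    discrete_measurable0 discrete_measurableC discrete_measurableU.

Definition mutually_independent (d d' : measure_display)
    (T : measurableType d) (T' : measurableType d') (R : realType)
    (P : probability T R) (I : finType) (X : I -> {RV P >-> T'}) : Prop :=
  forall (J : {set I}) (A : I -> set T'),
    (forall i, i \in J -> measurable (A i)) ->
    P (\bigcap_(i in [set` J]) (X i @^-1` A i)) =
      (\prod_(i in J) P (X i @^-1` A i))%E.

Definition join_families (A B V : Type) (x : A -> V) (y : B -> V)
    (k : A + B) : V :=
  match k with inl a => x a | inr b => y b end.

Definition tau (R : realType) (T : Type) (n : nat) (y yhat : 'I_n -> T -> 'I_2)
    (s : 'S_2) (t : T) : R :=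
  n%:R^-1 * \sum_(i < n) (y i t != s (yhat i t))%:R.

(* n times the Matching Error of the partitions [y] and [yhat], provided s1 and
   s2 are the two distinct permutations of the labels. *)
Definition n_tau (R : realType) (T : Type) (n : nat)
    (y yhat : 'I_n -> T -> 'I_2) (s1 s2 : 'S_2) (t : T) : R :=
  Num.min (n%:R * tau R y yhat s1 t) (n%:R * tau R y yhat s2 t).

Definition binomial_cdf (R : realType) (n : nat) (p : R) (z : nat) : \bar R :=
  binomial_prob n p [set k | (k <= z)%N].

(* Main.v *)
(* The number D of mismatches under one relabelling determines the one under the
   other, n - D, so n tau = min(D, n - D). The 2n labels are uniform on their
   2^(2n) values, and exactly 2^n values have a given mismatch set, so that set
   is uniform among the 2^n subsets. For 2z < n, the event n tau <= z is the
   disjoint union of the equally likely tails D <= z and n - D <= z; and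
   min(D, n - D) never exceeds n / 2. *)

Require Import Defs.
From mathcomp Require Import all_boot all_order all_algebra.
From mathcomp Require Import perm.
From mathcomp Require Import all_classical all_reals all_analysis.
From mathcomp Require Import zify lra.

Set Implicit Arguments.
Unset Strict Implicit.
Unset Printing Implicit Defensive.

Import Order.TTheory GRing.Theory Num.Theory.
Local Open Scope classical_set_scope.
Local Open Scope ring_scope.

(** The event splits into disjoint atoms, one for each assignment of values satisfying [Q].
    Independence over the full index set makes each atom a product of [#|I|] factors [p]. *)
Lemma prob_iid_uniform (R : realType) (d : measure_display)
    (T : measurableType d) (P : probability T R) (I : finType) (m : nat)
    (X : I -> {RV P >-> 'I_m.+1}) (p : R) (Q : {pred {ffun I -> 'I_m.+1}}) :
  mutually_independent X ->
  (forall i k, P (X i @^-1` [set k]) = p%:E) ->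
  P [set t | Q [ffun i => X i t]] = (p ^+ #|I| *+ #|Q|)%:E.
Proof.
move=> indep unif.
pose atom (w : {ffun I -> 'I_m.+1}) :=
  \bigcap_(i in [set` [set: I]%SET]) (X i @^-1` [set w i]).
have atomE w t : atom w t <-> [ffun i => X i t] = w.
  split=> [tw|<- i _]; last by rewrite /= ffunE.
  by apply/ffunP => i; rewrite ffunE; apply: tw; rewrite /= inE.
have matom w : measurable (atom w).
  by apply: fin_bigcap_measurable => // i _; apply: measurable_funPTI.
have Patom w : P (atom w) = (p ^+ #|I|)%:E.
  rewrite /atom (indep [set: I]%SET (fun i => [set w i])) //.
  under eq_bigr do rewrite unif.
  by rewrite prodEFin prodr_const cardsT.
have -> : [set t | Q [ffun i => X i t]] = \bigcup_(w in [set` Q]) atom w.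
  apply/seteqP; split=> t /=.
    by move=> Qt; exists [ffun i => X i t] => //; apply/atomE.
  by case=> w Qw /atomE ->.
rewrite measure_fin_bigcup //=; first last.
- by move=> v w _ _ [t [/atomE <- /atomE <-]].
rewrite -(@bigfs _ _ _ _ (index_enum _) Q) ?index_enum_uniq //; last first.
  by move=> w _; rewrite mem_index_enum.
under eq_bigr do rewrite Patom.
by rewrite sumEFin sumr_const.
Qed.

Lemma ord2_neqE (a b c : 'I_2) : a != b -> (c != b) = (c == a).
Proof.
by case: a => -[|[|//]] ?; case: b => -[|[|//]] ?; case: c => -[|[|//]].
Qed.

(** If they agreed at [k], injectivity would send the other label to the one remaining value under
    both, making them equal. *)
Lemma perm2_neq (s1 s2 : 'S_2) (k : 'I_2) : s1 != s2 -> s1 k != s2 k.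
Proof.
apply: contraNneq => eq_k; apply/eqP/permP => j.
have [-> //|neq_jk] := eqVneq j k.
have ne1 : s1 j != s1 k by rewrite (inj_eq perm_inj).
have ne2 : s2 j != s1 k by rewrite eq_k (inj_eq perm_inj).
by apply/eqP; rewrite -(ord2_neqE _ ne2).
Qed.

Definition mismatch (A : finType) (s : 'S_2) (w : {ffun A + A -> 'I_2}) :
  {set A} := [set i | w (inl i) != s (w (inr i))]%SET.

(* Choosing the second partition and the mismatch set freely determines the
   first partition, as there are only two labels. *)
Lemma card_mismatch (A : finType) (s : 'S_2) (Q : {pred {set A}}) :
  #|[pred w | Q (mismatch s w)]| = (2 ^ #|A| * #|Q|)%N.
Proof.
(* [s'] is [s] followed by the swap of the two labels; it supplies the first label wherever a
   mismatch is prescribed. *)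
have [s' neq_s] : exists s' : 'S_2, forall k, s' k != s k.
  exists (s * tperm ord0 ord_max)%g => k; rewrite permM.
  by case: (s k) => -[|[|[]]] // i; rewrite permE.
pose f (v : {ffun A -> 'I_2} * {set A}) : {ffun A + A -> 'I_2} :=
  [ffun k => match k with
             | inl a => if a \in v.2 then s' (v.1 a) else s (v.1 a)
             | inr a => v.1 a end].
pose g (w : {ffun A + A -> 'I_2}) := ([ffun a => w (inr a)], mismatch s w).
have fK : cancel f g.
  move=> [b S]; congr pair; first by apply/ffunP => a; rewrite !ffunE.
  by apply/setP => a; rewrite inE !ffunE /=; case: ifP; rewrite ?neq_s ?eqxx.
have gK : cancel g f.
  move=> w; apply/ffunP => -[a|a]; rewrite !ffunE //= inE.
  case: ifPn; last by move/negPn/eqP.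
  by rewrite (ord2_neqE _ (neq_s _)) => /eqP.
rewrite -(on_card_preimset (onW_bij _ (Bijective fK gK))).
rewrite -[X in (X ^ _)%N](card_ord 2) -card_ffun -cardX; apply: eq_card => v.
by rewrite !inE -[mismatch _ _]/(g (f v)).2 fK.
Qed.

Lemma card_sets_le (A : finType) (z : nat) :
  #|[pred S : {set A} | (#|S| <= z)%N]| = (\sum_(0 <= i < z.+1) 'C(#|A|, i))%N.
Proof.
rewrite big_mkord -sum1_card.
(* Sort the sets by cardinality. The default value of [inord] never interferes, since only sets with
   [#|S| <= z] are counted. *)
rewrite (partition_big (fun S : {set A} => inord #|S| : 'I_z.+1) predT) //=.
apply: eq_bigr => i _; rewrite -(card_draws A i) -sum1_card.
apply: eq_bigl => S; rewrite !inE -val_eqE /=.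
apply/andP/eqP => [[le_z]|->]; first by rewrite inordK // => /eqP.
by rewrite inordK // -ltnS.
Qed.

(** Complementation exchanges the two tails, so each has the size given by [card_sets_le]. A set in
    both would force [#|A| <= 2z]. *)
Lemma card_sets_tails (A : finType) (z : nat) :
  (z.*2 < #|A|)%N ->
  #|[pred S : {set A} | ((#|S| <= z) || (#|A| - #|S| <= z))%N]| =
    (2 * \sum_(0 <= i < z.+1) 'C(#|A|, i))%N.
Proof.
move=> lt_z; rewrite -card_sets_le mul2n -addnn.
pose lo := [pred S : {set A} | (#|S| <= z)%N].
pose hi := [pred S : {set A} | (#|A| - #|S| <= z)%N].
have card_hi : #|hi| = #|lo|.
  rewrite -(card_imset lo (@finset.setC_inj A)); apply: eq_card => S.
  apply/idP/imsetP => [|[S' loS' ->]]; rewrite !inE.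
    by move=> hiS; exists (~: S)%SET; rewrite ?finset.setCK // inE cardsCs finset.setCK.
  by rewrite -cardsCs.
rewrite -{2}card_hi -(cardUI lo hi) [X in (_ + X)%N]eq_card0 ?addn0; last first.
  move=> S; rewrite !inE; have := max_card S; lia.
by apply: eq_card => S; rewrite !inE.
Qed.

(** With two labels and [s1], [s2] differing everywhere, a mismatch under [s2] is a match under
    [s1], so the two mismatch sets are complementary. *)
Lemma n_tauE (R : realType) (T : Type) (n : nat) (y yhat : 'I_n -> T -> 'I_2)
    (s1 s2 : 'S_2) (t : T) :
  (0 < n)%N -> s1 != s2 ->
  let D := mismatch s1 [ffun k => join_families y yhat k t] in
  n_tau R y yhat s1 s2 t = (minn #|D| (n - #|D|))%:R.
Proof.
move=> n_gt0 neq_s D.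
have n_neq0 : n%:R != 0 :> R by rewrite pnatr_eq0 -lt0n.
have D1 : n%:R * tau R y yhat s1 t = #|D|%:R.
  rewrite /tau mulVKf // -natr_sum; congr _%:R.
  rewrite -sum1_card [RHS]big_mkcond; apply: eq_bigr => i _.
  by rewrite inE !ffunE /=; case: eqP.
have D2 : n%:R * tau R y yhat s2 t = (n - #|D|)%:R.
  rewrite /tau mulVKf // -natr_sum; congr _%:R.
  rewrite -[X in (X - _)%N](card_ord n) -[D]finset.setCK -cardsCs.
  rewrite -sum1_card [RHS]big_mkcond; apply: eq_bigr => i _.
  rewrite !inE !ffunE /= negbK (ord2_neqE _ (perm2_neq _ neq_s)).
  by case: eqP.
by rewrite /n_tau D1 D2 -natr_min.
Qed.

Lemma binomial_cdf_half (R : realType) (n z : nat) :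
  binomial_cdf n (1 / 2 : R) z =
    (\sum_(0 <= i < z.+1) 'C(n, i)%:R * (1 / 2) ^+ n)%:E.
Proof.
have half01 : 0 <= 1 / 2 :> R /\ 1 / 2 <= 1 :> R by lra.
have onem_half : unstable.onem (1 / 2 : R) = 1 / 2.
  by rewrite /unstable.onem; lra.
rewrite /binomial_cdf /binomial_prob; case: half01 => -> -> /=.
have -> : [set k | (k <= z)%N] = `I_z.+1 by [].
rewrite esum_fset //; last first.
  by move=> k _; rewrite lee_fin binomial_pmf_ge0 //; lra.
rewrite -fsbig_ord //= sumEFin big_mkord; congr _%:E; apply: eq_bigr => i _.
rewrite /binomial_pmf onem_half -exprD.
(* For [i > n] the truncated [n - i] spoils the exponent, but the binomial coefficient vanishes. *)
have [le_in|lt_ni] := leqP i n; first by rewrite subnKC // mulr_natl.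
by rewrite bin_small // mulr0n mul0r.
Qed.

Theorem proposition3 (R : realType) (d : measure_display)
    (T : measurableType d) (P : probability T R) (n : nat)
    (y yhat : 'I_n -> {RV P >-> 'I_2}) (s1 s2 : 'S_2) (z : nat)
    (hn : (1 <= n)%N)
    (hindep : mutually_independent (join_families y yhat))
    (hy : forall (i : 'I_n) (k : 'I_2), P (y i @^-1` [set k]) = (2^-1)%:E)
    (hyhat : forall (i : 'I_n) (k : 'I_2),
      P (yhat i @^-1` [set k]) = (2^-1)%:E)
    (hs : s1 != s2) :
  (z.+1%:R <= n%:R / 2 :> R ->
    P [set t | n_tau R y yhat s1 s2 t <= z%:R] =
      (\sum_(0 <= i < z.+1) 2 * 'C(n, i)%:R * (1 / 2) ^+ n)%:E
    /\ (\sum_(0 <= i < z.+1) 2 * 'C(n, i)%:R * (1 / 2) ^+ n)%:E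
       = (2%:E * binomial_cdf n (1 / 2 : R) z)%E)
  /\ (n%:R / 2 < z%:R :> R ->
    P [set t | n_tau R y yhat s1 s2 t <= z%:R] = 1%E).
Proof.
have sumE : \sum_(0 <= i < z.+1) 2 * 'C(n, i)%:R * (1 / 2) ^+ n =
    2 * \sum_(0 <= i < z.+1) 'C(n, i)%:R * (1 / 2) ^+ n :> R.
  by rewrite mulr_sumr; apply: eq_bigr => i _; rewrite mulrA.
split=> [|lt_nz].
  rewrite ler_pdivlMr // -natrM ler_nat => le_zn.
  split; last by rewrite sumE EFinM binomial_cdf_half.
  pose X := join_families y yhat.
  have unif k j : P (X k @^-1` [set j]) = (2^-1)%:E 
    by case: k => i; [exact: hy | exact: hyhat].
  pose Q := [pred S : {set 'I_n} | ((#|S| <= z) || (#|'I_n| - #|S| <= z))%N].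
  pose E := [pred w : {ffun 'I_n + 'I_n -> 'I_2} | Q (mismatch s1 w)].
  have -> : [set t | n_tau R y yhat s1 s2 t <= z%:R] =
      [set t | E [ffun k => X k t]].
    (* Joining the underlying functions and joining the random variables agree only after a case
       split on the index. *)
    have joinE t : [ffun k => join_families (V := T -> 'I_2) y yhat k t] =
        [ffun k => X k t].
      by apply/ffunP => -[i|i]; rewrite !ffunE.
    apply/funext => t; rewrite /mkset n_tauE // ler_nat geq_min.
    by rewrite joinE /E /Q /= card_ord.
  rewrite (prob_iid_uniform _ hindep unif) card_mismatch card_sets_tails;
    last by rewrite card_ord; lia.
  rewrite card_sum !card_ord sumE; congr _%:E.
  (* Each of the favourable outcomes weighs [2^-1 ^+ (n + n)]; the [2 ^ n] choices of the second
     partition cancel one factor [2^-1 ^+ n]. *)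
  rewrite -mulr_natl -mulr_suml !natrM natr_sum natrX div1r.
  by rewrite exprD mulrACA -exprMn mulfV // expr1n mul1r mulrA.
have -> : [set t | n_tau R y yhat s1 s2 t <= z%:R] = setT.
  apply/seteqP; split=> // t _; rewrite /= n_tauE // ler_nat.
  move: lt_nz; rewrite ltr_pdivrMr // -natrM ltr_nat; lia.
exact: probability_setT.
Qed.
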